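(* Let $Q=\{1,2,\ldots,n\}$ be a naturally ordered semigroup with a $k$-translatable sequence $a_1,a_2,\ldots,a_n$ in which (1) $a_1=a_2=n$, or (2) $a_1=1$ and $a_j=j+1$ for some $j\ne 1$. Then the multiplication of $Q$ is given by the formula $i\cdot j=a_j$ for all $i,j\in Q$.
   Context: A semigroup is a set with an associative binary operation $\cdot$. For an integer $x$, $[x]_n$ denotes the residue of $x$ modulo $n$, represented in $\{1,\ldots,n\}$, with $0$ identified with $n$. For $1\le k<n$, $Q=\{1,\ldots,n\}$ with a binary operation is $k$-translatable (with respect to the natural ordering) if in its multiplication table each row $i$, $2\le i\le n$, is obtained from row $i-1$ by cyclically shifting it $k$ places to the right, i.e. $i\cdot j=(i-1)\cdot[j-k]_n$ for all $j$ and all $2\le i\le n$. Saying that $Q$ has the $k$-translatable sequence $a_1,\ldots,a_n$ means that $Q$ is $k$-translatable and its first row is $a_j=1\cdot j$, $j=1,\ldots,n$. *)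

(* Defs.v *)
From HB Require Import structures.
From mathcomp Require Import all_boot all_order all_algebra.

Set Implicit Arguments.
Unset Strict Implicit.
Unset Printing Implicit Defensive.

Import GRing.Theory.

Definition Q (n : nat) : pred nat := [pred i | 1 <= i <= n].

(* [x]_n, with representatives 1, ..., n instead of 0, ..., n - 1 (for n > 0) *)
Definition residue (n : nat) (x : int) : nat :=
  let r := `|(x %% n%:Z)%Z|%N in if r == 0 then n else r.

(* An operation on Q n is a function on nat whose values outside Q n are
   irrelevant. *)
Definition is_semigroup (n : nat) (op : nat -> nat -> nat) : Prop :=
  {in Q n &, forall i j, op i j \in Q n} /\ {in Q n & &, associative op}.

Definition translatable (n k : nat) (op : nat -> nat -> nat) : Prop :=
  forall i j : nat, 2 <= i <= n -> j \in Q n ->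
    op i j = op (i - 1) (residue n (j%:Z - k%:Z)%R).

Definition has_translatable_sequence (n k : nat) (op : nat -> nat -> nat)
    (a : nat -> nat) : Prop :=
  translatable n k op /\ {in Q n, forall j, a j = op 1 j}.

(* Main.v *)
Require Import Defs.
From mathcomp Require Import all_boot all_order all_algebra.
From mathcomp Require Import zify ring.

Import GRing.Theory.

(** Read the first row as an [n]-periodic function [f] on the integers.
    Translatability says [i * j = f (j - k (i - 1))], so the conclusion
    [i * j = a_j] amounts to [f] being [k]-periodic.  Associativity of the
    triples [(1, j, l)] alone gives the functional equation
<<
      f (l - k (f j - 1)) = f (f (l - k (j - 1)))       ([first_row_assoc])
>>
    for every [j] in [Q] and every integer [l], and two values of [j] suffice
    to extract the period.
    - If [f 1 = f 2 = n], then [j = 1] gives [f (l + k) = f (f l)] and [j = 2]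
      gives [f (l + k) = f (f (l - k))]; the right-hand side of the latter is
      [f l] by the former.
    - If [f 1 = 1] and [f j = j + 1], then [j = 1] gives [f l = f (f l)], so
      that at [j] the equation becomes [f (l - k j) = f (l - k j + k)]. *)

(** The first row of the table as an [n]-periodic function on the integers, on
    which shifts of columns are plain subtractions. *)
Definition first_row (n : nat) (op : nat -> nat -> nat) (x : int) : nat :=
  op 1 (residue n x).

Lemma residue_in (n : nat) (x : int) : 0 < n -> residue n x \in Q n.
Proof.
move=> n_gt0; rewrite inE /residue /=.
have ge0 : (0 <= (x %% n%:Z)%Z)%R by apply: modz_ge0; lia.
have ltn : ((x %% n%:Z)%Z < n%:Z)%R by apply: ltz_pmod; lia.
by case: eqP => ?; lia.
Qed.

Lemma residue_id (n j : nat) : j \in Q n -> residue n (Posz j) = j.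
Proof.
rewrite inE /= => /andP[j_gt0]; rewrite /residue leq_eqVlt.
case/orP=> [/eqP-> | lt_jn]; first by rewrite modzz.
by rewrite modz_small ?absz_nat; [case: eqP; lia | lia].
Qed.

Lemma residue_addMn (n : nat) (x c : int) :
  residue n (x + c * n%:Z)%R = residue n x.
Proof. by rewrite /residue addrC modzMDl. Qed.

Lemma residue_congr (n : nat) (x : int) :
  0 < n -> exists c : int, Posz (residue n x) = (x + c * n%:Z)%R.
Proof.
move=> n_gt0; rewrite /residue.
have ge0 : (0 <= (x %% n%:Z)%Z)%R by apply: modz_ge0; lia.
have xE := divz_eq x n.
case: eqP => r0; [exists (1 - (x %/ n%:Z)%Z)%R | exists (- (x %/ n%:Z)%Z)%R].
  have {}r0 : (x %% n%:Z)%Z = 0%R by lia.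
  rewrite {1}xE r0; ring.
rewrite gez0_abs // {2}xE; ring.
Qed.

Section FirstRow.

Variables (n k : nat) (op : nat -> nat -> nat).
Hypothesis n_gt0 : 0 < n.
Hypothesis opT : translatable n k op.

Local Notation f := (first_row n op).

Lemma first_row_addMn (x c : int) : f (x + c * n%:Z)%R = f x.
Proof. by rewrite /first_row residue_addMn. Qed.

Lemma first_rowE (j : nat) : j \in Q n -> f (Posz j) = op 1 j.
Proof. by move=> jQ; rewrite /first_row residue_id. Qed.

Lemma op_first_row (i j : nat) :
  i \in Q n -> j \in Q n -> op i j = f (j%:Z - k%:Z * (i%:Z - 1))%R.
Proof.
case: i => [|i] //; elim: i j => [|i IH] j iQ jQ.
  by rewrite subrr mulr0 subr0 first_rowE.
have iQ' : i.+1 \in Q n by move: iQ; rewrite !inE /=; lia.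
rewrite opT //.
rewrite subn1 /= IH ?residue_in //.
have [c ->] := residue_congr n (j%:Z - k%:Z)%R n_gt0.
rewrite -[RHS](first_row_addMn _ c); congr first_row.
have -> : (i.+2%:Z = i.+1%:Z + 1)%R by lia.
ring.
Qed.

Lemma first_row_in (x : int) : is_semigroup n op -> f x \in Q n.
Proof.
by case=> opQ _; apply: opQ; rewrite ?residue_in // inE /= n_gt0.
Qed.

(** This is [(1 * j) * l = 1 * (j * l)]; both sides are [n]-periodic in [l],
    so [l] may be any integer. *)
Lemma first_row_assoc (j : nat) (l : int) :
  is_semigroup n op -> j \in Q n ->
  (f (l - k%:Z * ((f j%:Z)%:Z - 1)) = f (f (l - k%:Z * (j%:Z - 1)))%:Z)%R.
Proof.
move=> opS jQ; have [opQ opA] := opS.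
have Q1 : 1 \in Q n by rewrite inE /= n_gt0.
have lQ := residue_in n l n_gt0.
have := opA _ _ _ Q1 jQ lQ; rewrite -(first_rowE j) //.
rewrite (op_first_row j) // (op_first_row (f (Posz j))) ?first_row_in //.
rewrite -first_rowE ?first_row_in //.
have [c ->] := residue_congr n l n_gt0.
rewrite -![(l + c * n%:Z - _)%R]addrAC !first_row_addMn.
by move=> ->.
Qed.

Lemma first_row_period_const :
  is_semigroup n op -> 2 <= n -> op 1 1 = n -> op 1 2 = n ->
  forall x : int, f (x - k%:Z)%R = f x.
Proof.
move=> opS n_ge2 f1 f2 x.
have Q1 : 1 \in Q n by rewrite inE /= n_gt0.
have Q2 : 2 \in Q n by rewrite inE /= n_ge2.
have shift (l : int) : f (l - k%:Z * (n%:Z - 1))%R = f (l + k%:Z)%R.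
  rewrite -[RHS](first_row_addMn _ (- k%:Z)%R); congr first_row; ring.
have at1 (l : int) : (f (l + k%:Z) = f (f l)%:Z)%R.
  have := first_row_assoc 1 l opS Q1.
  by rewrite first_rowE // f1 shift subrr mulr0 subr0.
have at2 : (f x = f (f (x - k%:Z - k%:Z))%:Z)%R.
  have := first_row_assoc 2 (x - k%:Z)%R opS Q2.
  by rewrite first_rowE // f2 shift subrK mulr1.
by rewrite at2 -at1 subrK.
Qed.

Lemma first_row_period_succ (j : nat) :
  is_semigroup n op -> j \in Q n -> op 1 1 = 1 -> op 1 j = j + 1 ->
  forall x : int, f (x - k%:Z)%R = f x.
Proof.
move=> opS jQ f1 fj x.
have Q1 : 1 \in Q n by rewrite inE /= n_gt0.
have idem (l : int) : (f (f l)%:Z = f l)%R.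
  have := first_row_assoc 1 l opS Q1.
  by rewrite first_rowE // f1 subrr mulr0 subr0.
have := first_row_assoc j (x + k%:Z * (j%:Z - 1))%R opS jQ.
rewrite first_rowE // fj idem addrK PoszD addrK => <-.
congr first_row; ring.
Qed.

Lemma op_eq_first_row :
  (forall x : int, f (x - k%:Z)%R = f x) ->
  {in Q n &, forall i j, op i j = op 1 j}.
Proof.
move=> per i j iQ jQ; rewrite op_first_row // -(first_rowE j) //.
case: i iQ => // i _; elim: i => [|i IH]; first by rewrite subrr mulr0 subr0.
rewrite -IH -[RHS]per; congr first_row.
have -> : (i.+2%:Z = i.+1%:Z + 1)%R by lia.
ring.
Qed.

End FirstRow.

Theorem corollary5p24 (n k : nat) (op : nat -> nat -> nat) (a : nat -> nat)
    (hk : 1 <= k < n)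
    (hS : is_semigroup n op)
    (ha : has_translatable_sequence n k op a)
    (h12 : (a 1 = n /\ a 2 = n) \/
           (a 1 = 1 /\ exists j : nat, [/\ j \in Q n, j <> 1 & a j = j + 1])) :
  {in Q n &, forall i j, op i j = a j}.
Proof.
have [opT aE] := ha.
have n_ge2 : 2 <= n by lia.
have n_gt0 : 0 < n by lia.
have Q1 : 1 \in Q n by rewrite inE /= n_gt0.
have Q2 : 2 \in Q n by rewrite inE /= n_ge2.
have per : forall x : int, first_row n op (x - k%:Z)%R = first_row n op x.
  case: h12 => [[] | [a1 [j [jQ _ aj]]]].
    by rewrite !aE //; apply: first_row_period_const.
  by apply: (first_row_period_succ _ _ _ n_gt0 opT j); rewrite -?aE.
by move=> i j iQ jQ; rewrite aE //; apply: (op_eq_first_row n k).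
Qed.
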